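(* Let $X$ be a real or complex Banach space and let $\mathfrak A$ be a strictly semi-transitive subalgebra of $\mathcal L(X)$. Then $\operatorname{Lat}\mathfrak A$ is well-ordered by reverse inclusion. That is, $\operatorname{Lat}\mathfrak A$ is totally ordered by inclusion and every non-empty subset of $\operatorname{Lat}\mathfrak A$ has a maximal element with respect to inclusion.
   Context: $\mathcal L(X)$ is the algebra of all bounded linear operators on $X$; a subalgebra need not be unital or closed. $\mathfrak A$ is strictly semi-transitive if for all non-zero $x,y\in X$ there exists $A\in\mathfrak A$ such that $Ax=y$ or $Ay=x$. $\operatorname{Lat}\mathfrak A$ is the lattice of all norm-closed linear subspaces $Y\subseteq X$ that are $\mathfrak A$-invariant, i.e. $AY\subseteq Y$ for all $A\in\mathfrak A$. *)

(* Defs.v *)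
From HB Require Import structures.
From mathcomp Require Import all_boot all_order all_algebra.
From mathcomp Require Import complex.
From mathcomp Require Import all_classical all_reals topology normedtype.
Set Implicit Arguments.
Unset Strict Implicit.
Unset Printing Implicit Defensive.
Import Order.TTheory GRing.Theory Num.Theory.
Import numFieldNormedType.Exports.
Local Open Scope classical_set_scope.
Local Open Scope ring_scope.

Variant scalars := RealScalars | ComplexScalars.

Definition scalar_field (R : realType) (k : scalars) : numFieldType :=
  match k with
  | RealScalars => R
  | ComplexScalars => R[i]
  end.

Section operators.
Variables (K : numFieldType) (X : normedModType K).

Definition bounded_operators : set (X -> X) :=
  [set T | linear T /\ exists M : K, forall x, `|T x| <= M * `|x|].

(* [submod_closed] refers to the pointwise vector space structure on [X -> X].
   The identity operator need not belong to the algebra. *)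
Definition is_subalgebra (A : set (X -> X)) : Prop :=
  [/\ A `<=` bounded_operators,
      submod_closed (mem A)
    & forall S T, A S -> A T -> A (S \o T)].

Definition strictly_semi_transitive (A : set (X -> X)) : Prop :=
  forall x y : X, x != 0 -> y != 0 ->
  exists2 T, A T & T x = y \/ T y = x.

Definition Lat (A : set (X -> X)) : set (set X) :=
  [set Y | [/\ closed Y, submod_closed (mem Y)
             & forall T, A T -> T @` Y `<=` Y]].

End operators.

(* Main.v *)
(* If [y] and [z] witness that neither of two invariant subspaces contains the
   other, no operator of the algebra maps one of [y], [z] to the other; hence
   totality.  For maximal elements, suppose [Y 0 < Y 1 < ...] is strictly
   increasing in [Lat A].  Choose unit vectors [w n] in [Y n.+1] at distance at
   least [d n > 0] from [Y n], and put [s b = \sum_(n | odd n == b) eps n *: w n]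
   with [eps n] decreasing so fast that the tail after [n] is of order
   [eps n * d n / n].  For [n] of parity [~~ b], the distance of [s (~~ b)] to
   [Y n] is of order [eps n * d n], that of [s b] only [eps n * d n / n].  An
   operator with bound [M] preserving [Y n] increases distances to [Y n] at most
   by the factor [M], so it cannot map [s b] to [s (~~ b)], contradicting strict
   semi-transitivity. *)
Require Import Defs.
From mathcomp Require Import all_boot all_order all_algebra.
From mathcomp Require Import complex.
From mathcomp Require Import all_classical all_reals topology normedtype.
Import Order.TTheory GRing.Theory Num.Theory.
Import numFieldNormedType.Exports.
Local Open Scope classical_set_scope.
Local Open Scope ring_scope.

(* For [K = R[i]], [0 <= M] says that [M] is a nonnegative real number. *)
Definition archimedean (K : numDomainType) : Prop :=
  forall M : K, 0 <= M -> exists n : nat, M < n%:R.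

Lemma scalar_field_archimedean (R : realType) (k : scalars) :
  archimedean (scalar_field R k).
Proof.
case: k => /= M M0; first by exists (Num.bound M); rewrite archi_boundP.
case: M M0 => x y; rewrite lecE /= => /andP[/eqP-> x0].
exists (Num.bound x); rewrite -(rmorph_nat (real_complex R)) ltcR.
exact: archi_boundP.
Qed.

(** Halving bounds the tail from index [n] on by [eps n *+ 2]; a further [eps n] pays for replacing
    the limit by a late partial sum. Over a general [K], halving alone does not force [eps] to tend
    to 0, whence [archimedean K]. *)
Lemma summable_series_cvg (K : numFieldType) (X : completeNormedModType K)
    (v : nat -> X) (eps : nat -> K) :
  archimedean K -> (forall n, 0 < eps n) ->
  (forall n, eps n.+1 *+ 2 <= eps n) -> (forall n, `|v n| <= eps n) ->
  exists s, forall n, `|s - \sum_(i < n) v i| <= eps n *+ 3.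
Proof.
move=> archK eps0 epsS veps; pose S n := \sum_(i < n) v i.
(* The subtracted term makes the induction telescope: each new term is at most
   [eps (n + m) *+ 2 - eps (n + m).+1 *+ 2]. *)
have Sle n m : `|S (n + m)%N - S n| <= eps n *+ 2 - eps (n + m)%N *+ 2.
  elim: m => [|m IH]; first by rewrite addn0 !subrr normr0.
  rewrite addnS /S big_ord_recr /= -/(S _) addrAC.
  apply: (le_trans (ler_normD _ _)); apply: (le_trans (lerD IH (veps _))).
  rewrite -addrA lerD2l mulr2n opprD -addrA addNr addr0 lerN2.
  exact: epsS.
have Sle2 n m : (n <= m)%N -> `|S m - S n| <= eps n *+ 2.
  move=> nm; rewrite -(subnKC nm); apply: (le_trans (Sle _ _)).
  by rewrite gerBl mulrn_wge0// ltW.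
have epsn n : eps n * n.+1%:R <= eps 0%N.
  elim: n => [|n IH]; first by rewrite mulr1.
  apply: le_trans IH; apply: (@le_trans _ _ (eps n.+1 *+ 2 * n.+1%:R)).
    rewrite mulrnAl -mulrnAr ler_wpM2l ?(ltW (eps0 _))// -[_ *+ 2]mulr_natr -natrM ler_nat.
    by rewrite muln2 -addnn addSn addnS !ltnS leq_addr.
  by rewrite ler_wpM2r.
have eps_small e : 0 < e -> exists n, eps n *+ 2 < e.
  move=> e0; have [n ltn] : exists n, eps 0%N *+ 2 / e < n%:R.
    by apply: archK; rewrite divr_ge0 ?mulrn_wge0 ?ltW.
  exists n; rewrite ltr_pdivrMr// in ltn.
  have: eps n *+ 2 * n.+1%:R < e * n.+1%:R.
    apply: (le_lt_trans (y := eps 0%N *+ 2)).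
      by rewrite mulrnAl lerMn2r epsn.
    apply: (lt_le_trans ltn); rewrite mulrC ler_wpM2l ?(ltW e0)// ler_nat.
    exact: leqnSn.
  by rewrite ltr_pM2r// ltr0n.
have cS : cvg (S @ \oo).
  apply: cauchy_cvg; apply: cauchy_exP => e e0; have [n ne] := eps_small e e0.
  exists (S n); exists n => // m /= nm; rewrite -ball_normE /= distrC.
  exact: le_lt_trans (Sle2 _ _ nm) ne.
exists (lim (S @ \oo)) => n.
have /cvgrPdist_lt/(_ _ (eps0 n)) [m _ Hm] := cS.
have := Hm (maxn m n) (leq_maxl _ _) => /ltW le1.
rewrite -(subrK (S (maxn m n)) (lim _)) -addrA mulrS.
by apply: (le_trans (ler_normD _ _)); apply: lerD le1 (Sle2 _ _ (leq_maxr _ _)).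
Qed.

Section invariant_subspaces.
Variables (K : numFieldType) (X : normedModType K).
Implicit Types (Y : set X) (A : set (X -> X)).

Lemma submod_closedP Y : submod_closed (mem Y) ->
  Y 0 /\ forall a u v, Y u -> Y v -> Y (a *: u + v).
Proof.
move=> [Y0 YL]; split; first exact: set_mem Y0.
by move=> a u v Yu Yv; apply: set_mem; apply: YL; apply: mem_set.
Qed.

(** The witness [d] is the radius of a ball around [w] that misses [Y]; infima of distances need not
    exist in [K]. *)
Lemma closed_dist_gt0 Y (w : X) : closed Y -> ~ Y w ->
  exists2 d : K, 0 < d & forall u, Y u -> d <= `|w - u|.
Proof.
move=> cY nYw.
have /nbhs_ballP[d /= d0 dY] : nbhs w (~` Y).
  by apply: open_nbhs_nbhs; split => //; exact: closed_openC.
exists d => // u Yu; rewrite real_leNgt ?ger0_real ?(ltW d0)//.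
apply/negP => wu; apply: (dY u) => //.
by rewrite -ball_normE.
Qed.

Lemma Lat_total A : strictly_semi_transitive A -> total_on (Lat A) subset.
Proof.
move=> sst Y Z [_ /submod_closedP[Y0 _] YA] [_ /submod_closedP[Z0 _] ZA].
apply: contrapT => /not_orP[/existsNP[y /not_implyP[Yy nZy]]].
move=> /existsNP[z /not_implyP[Zz nYz]].
have y0 : y != 0 by apply: contra_notN nZy => /eqP->.
have z0 : z != 0 by apply: contra_notN nYz => /eqP->.
have [T AT [Tyz|Tzy]] := sst y z y0 z0.
  by apply: nYz; apply: (YA T AT); exists y.
by apply: nZy; apply: (ZA T AT); exists z.
Qed.

End invariant_subspaces.

Lemma no_increasing_chain (K : numFieldType) (X : completeNormedModType K)
    (A : set (X -> X)) (Y : nat -> set X) :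
  archimedean K -> A `<=` @bounded_operators K X ->
  strictly_semi_transitive A ->
  (forall n, Lat A (Y n)) -> (forall n, Y n `<` Y n.+1) -> False.
Proof.
move=> archK Abnd sst LY ltY.
have Y0 n : Y n 0 by have [_ /submod_closedP[]] := LY n.
have YL n a u v : Y n u -> Y n v -> Y n (a *: u + v).
  by have [_ /submod_closedP[_ +] _] := LY n; apply.
have YT n T u : A T -> Y n u -> Y n (T u).
  by move=> AT Yu; have [_ _ +] := LY n; move=> /(_ T AT); apply; exists u.
have /choice[wd wdP] : forall n, exists wd : X * K, [/\ Y n.+1 wd.1,
    `|wd.1| = 1, 0 < wd.2 & forall u, Y n u -> wd.2 <= `|wd.1 - u|].
  move=> n; have [cY _ _] := LY n.
  have [_ /existsNP[x /not_implyP[Yx nYx]]] := ltY n.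
  have x0 : `|x| != 0.
    by rewrite normr_eq0; apply: contra_notN nYx => /eqP->.
  pose w := `|x|^-1 *: x.
  have nYw : ~ Y n w.
    move=> /(YL n `|x| _ 0)/(_ (Y0 n)); rewrite addr0 scalerA divff// scale1r.
    exact: nYx.
  have [d d0 dY] := closed_dist_gt0 _ _ _ _ cY nYw.
  exists (w, d); split => //=.
    by rewrite /w -(addr0 (_ *: _)); apply: YL.
  by rewrite normrZ normfV normr_id mulVf.
pose w n := (wd n).1; pose d n := (wd n).2.
have d0 n : 0 < d n by have [] := wdP n.
have w1 n : `|w n| = 1 by have [] := wdP n.
have Yw n : Y n.+1 (w n) by have [] := wdP n.
have dw n u : Y n u -> d n <= `|w n - u| by have [_ _ _] := wdP n; apply.
have d1 n : d n <= 1 by rewrite -(w1 n) -(subr0 (w n)); apply: dw.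
(* The 4 is there to beat the 3 of the tail estimate, and the growing factor [i.+1] to beat any
   operator bound. *)
pose eps n := \prod_(i < n) (d i / (4 * i.+1)%:R).
have eps0 n : 0 < eps n by apply: prodr_gt0 => i _; rewrite divr_gt0// ltr0n.
have epsE n : eps n.+1 * (4 * n.+1)%:R = eps n * d n.
  by rewrite /eps big_ord_recr /= -mulrA divfK// pnatr_eq0.
have eps2 n : eps n.+1 *+ 2 <= eps n.
  apply: (@le_trans _ _ (eps n * d n)).
    by rewrite -epsE -mulr_natr ler_wpM2l ?(ltW (eps0 _))// ler_nat; case: n.
  by rewrite ler_piMr// ltW.
pose v (b : bool) n := if odd n == b then eps n *: w n else 0.
pose S (b : bool) n := \sum_(i < n) v b i.
have SS b n : S b n.+1 = S b n + v b n by rewrite /S big_ord_recr.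
have YS b n : Y n (S b n).
  elim: n => [|n IH]; first by rewrite /S big_ord0.
  rewrite SS addrC /v; have [le _] := ltY n.
  by case: ifP => _; [apply: YL => //; apply: le|rewrite add0r; apply: le].
have /choice[s sP] : forall b : bool, exists s, forall n, `|s - S b n| <= eps n *+ 3.
  move=> b; apply: summable_series_cvg => // n; rewrite /v; case: ifP => _.
    by rewrite normrZ w1 mulr1 gtr0_norm.
  by rewrite normr0 ltW.
(* The term [eps n *: w n] of [s b] stays at distance [eps n * d n] from [Y n]; earlier terms lie in
   [Y n], and later ones cost at most [eps n.+1 *+ 3]. *)
have gap b n u : odd n = b -> Y n u ->
    eps n * d n <= `|s b - u| + eps n.+1 *+ 3.
  move=> nb Yu.
  have YuS : Y n ((eps n)^-1 *: (u - S b n)).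
    rewrite -[X in Y n X]addr0; apply: (YL) => //.
    by rewrite addrC -[- S b n]scaleN1r; apply: YL.
  have /(ler_wpM2l (ltW (eps0 n))) := dw n _ YuS.
  rewrite -[X in _ <= X * _](gtr0_norm (eps0 n)) -normrZ scalerBr scalerA.
  rewrite divff ?lt0r_neq0// scale1r => /le_trans; apply.
  have -> : eps n *: w n - (u - S b n) = (s b - u) - (s b - S b n.+1).
    rewrite SS /v nb eqxx !opprB [RHS]addrC [RHS]addrA subrK.
    by rewrite addrCA addrA.
  by apply: (le_trans (ler_normB _ _)); rewrite lerD2l.
have eps3 n : eps n.+1 *+ 3 < eps n * d n.
  by rewrite -epsE -mulr_natr ltr_pM2l// ltr_nat mulnS.
have s_neq0 b : s b != 0.
  (* Read as a number, [b] is an index of parity [b], so [gap] applies there with [u = 0]. *)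
  apply/eqP => sb0; have := gap b b 0; rewrite sb0 subrr normr0 add0r oddb.
  by move=> /(_ erefl (Y0 _))/le_lt_trans-/(_ _ (eps3 b)); rewrite ltxx.
have sst_false b T : A T -> T (s b) = s (~~ b) -> False.
  move=> AT Ts; have [linT [M TM]] := Abnd T AT.
  have M0 : 0 <= M.
    have := le_trans (normr_ge0 _) (TM (s b)).
    by rewrite pmulr_lge0// normr_gt0.
  have [m] := archK _ M0.
  (* This index is at least [m], so that [M <= n%:R], and its term occurs in [s (~~ b)] but not in
     [s b]. *)
  pose n := (m.*2 + ~~ b)%N.
  have nb : odd n = ~~ b by rewrite oddD odd_double oddb.
  have mn : (m <= n)%N by rewrite /n -addnn -addnA leq_addr.
  move=> Mm; have Mn : M <= n%:R by rewrite (le_trans (ltW Mm))// ler_nat.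
  have TB : s (~~ b) - T (S b n) = T (s b - S b n).
    by rewrite -Ts [in RHS]addrC -[- S b n]scaleN1r linT scaleN1r addrC.
  have SSn : S b n.+1 = S b n by rewrite SS /v nb; case: (b); rewrite addr0.
  (* Take [u = T (S b n)] in [gap]: then [eps n * d n] is at most [M + 1] times [eps n.+1 *+ 3], and
     [eps n.+1] cancels. With [M <= n%:R] this forces 4 to be at most 3. *)
  have le4 : (4 * n.+1)%:R <= (M + 1) * 3.
    rewrite -(ler_pM2l (eps0 n.+1)) epsE.
    apply: (le_trans (gap (~~ b) n _ nb (YT _ _ _ AT (YS b n)))).
    rewrite TB -SSn mulrCA mulr_natr mulrDl mul1r lerD2r.
    by apply: (le_trans (TM _)); rewrite ler_wpM2l.
  have: (4 * n.+1)%:R <= (3 * n.+1)%:R :> K.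
    apply: (le_trans le4); rewrite mulrC natrM ler_wpM2l//.
    by rewrite -natr1 lerD2r.
  by rewrite ler_nat leq_pmul2r.
have [T AT] := sst _ _ (s_neq0 true) (s_neq0 false).
by case; [exact: (sst_false true) | exact: (sst_false false)].
Qed.

Theorem theorem3p8 (R : realType) (k : scalars)
    (X : completeNormedModType (scalar_field R k)) (A : set (X -> X)) :
  is_subalgebra A -> strictly_semi_transitive A ->
  total_on (Lat A) subset /\
  forall F : set (set X), F `<=` Lat A -> F !=set0 ->
    exists2 Y, F Y & forall Z, F Z -> Y `<=` Z -> Z = Y.
Proof.
move=> [Abnd _ _] sst; split; first exact: Lat_total.
move=> F FL [Y0 FY0]; apply: contrapT => nomax.
(* The premise [F Y] sits under the existential to make [f] total; iterating [f] from [Y0] never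
   leaves [F] and gives the forbidden chain. *)
have /choice[f fP] : forall Y, exists Z, F Y -> F Z /\ Y `<` Z.
  move=> Y; have [FY|nFY] := pselect (F Y); last by exists Y.
  apply: contrapT => noZ; apply: nomax; exists Y => // Z FZ YZ.
  apply: contrapT => ZY; apply: noZ; exists Z => _; split => //.
  by split => // ZsY; apply: ZY; apply/seteqP.
have FI n : F (iter n f Y0) by elim: n => // n /fP[].
apply: (@no_increasing_chain _ _ A (fun n => iter n f Y0)) => //.
- exact: scalar_field_archimedean.
- by move=> n; apply: FL.
- by move=> n; have [] := fP _ (FI n).
Qed.
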